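(* Let $f:\mathbb{R}\to\mathbb{R}$ be a $C^2$ function. The surfaces $\Sigma=\{(a,\rho):a=f(\rho)\}$ in the affine-additive group $\mathcal{AA}$ that have constant symplectic distortion $Q^h_\Sigma=q$ are the following: (1) the family defined by $$f(\rho)=\frac12\left(\pm\sqrt{c\rho^2+c-1}\mp\arctan\left(\sqrt{c\rho^2+c-1}\right)+\arctan(\rho)\right)+C,\qquad c>0,\ C\in\mathbb{R},\ \rho^2>\frac1c-1,$$ if $q=0$; (2) the two parameter family defined by the integral $$f(\rho)=\int_{\rho_0}^{\rho}\frac{s\left(\left(\frac{c_1}{s}-\frac q2\right)\pm\sqrt{-c_1^2+c_1qs-\frac14(q^2-4)s^2+1}\right)}{(s^2+1)(2c_1-qs)}\,ds,$$ for a constant $\rho_0\neq0$ and a constant $c_1$, if $q\neq0$.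
   Context: The affine-additive group $\mathcal{AA}$ is $\{(a,\lambda,t):a\in\mathbb{R},\lambda>0,t\in\mathbb{R}\}$ with group law $(a,\lambda,t)\cdot(a',\lambda',t')=(a+a',\lambda\lambda',\lambda t'+t)$. Its left-invariant frame is $V=2\lambda\,\partial_\lambda$, $U=\partial_a+2\lambda\,\partial_t$, $W=-\partial_a$, with $[V,U]=2(U+W)$ the only non-vanishing bracket; the horizontal distribution is spanned by the orthonormal fields $V,U$. For a surface $\Sigma=\{u=0\}$ with $C^2$ defining function $u$, put $\|\nabla_Hu\|=\sqrt{(Vu)^2+(Uu)^2}$. At non-characteristic points (those where $\|\nabla_Hu\|\neq0$) the symplectic distortion is $$Q^h_\Sigma=V\left(\frac{Uu}{\|\nabla_Hu\|}\right)-U\left(\frac{Vu}{\|\nabla_Hu\|}\right)-2\frac{Uu}{\|\nabla_Hu\|}.$$ The surfaces $\Sigma=\{(a,\rho):a=f(\rho)\}$ are the surfaces of revolution $u=a-f(\rho)=0$ with $\rho=t/\lambda$ (invariant under $(a,\lambda,t)\mapsto(a,\delta\lambda,\delta t)$, $\delta>0$); their characteristic points are the points with $\rho=0$ and $f'(0)=\frac12$.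
   Formalization: In (2) an additive constant is allowed, ρ/(2c1−qρ)>0 is required (otherwise the distortion is −q), and c1 is chosen on each interval without characteristic points. The sign ± may switch at zeros of the radicand; in (1) ρ=0 is allowed when c=1. *)

(* Defs.v *)
From Stdlib Require Import Reals.
From Coquelicot Require Import Coquelicot.
Open Scope R_scope.

(** The affine-additive group is the half-space [0 < l] of R^3 with coordinates
    [(a, l, t)].  A function on it is a curried function of the three
    coordinates; every use below is at a point with [0 < l], and all the
    derivatives involved only depend on the values near that point. *)
Definition AAfun := R -> R -> R -> R.

Definition V (F : AAfun) : AAfun := fun a l t =>
  2 * l * Derive (fun l' => F a l' t) l.

Definition U (F : AAfun) : AAfun := fun a l t =>
  Derive (fun a' => F a' l t) a + 2 * l * Derive (fun t' => F a l t') t.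

Definition hgrad_norm (u : AAfun) : AAfun := fun a l t =>
  sqrt (V u a l t ^ 2 + U u a l t ^ 2).

Definition distortion (u : AAfun) : AAfun := fun a l t =>
  V (fun a l t => U u a l t / hgrad_norm u a l t) a l t
  - U (fun a l t => V u a l t / hgrad_norm u a l t) a l t
  - 2 * (U u a l t / hgrad_norm u a l t).

Definition open_itv (x y : Rbar) (r : R) : Prop := Rbar_lt x r /\ Rbar_lt r y.

Definition C2_on (x y : Rbar) (f : R -> R) : Prop :=
  forall r, open_itv x y r ->
    ex_derive f r /\ ex_derive (Derive f) r /\ continuous (Derive (Derive f)) r.

Definition rev_fun (f : R -> R) : AAfun := fun a l t => a - f (t / l).

(** The part of the surface of revolution of [f] lying over the profile
    interval [(x, y)]. *)
Definition on_surface (f : R -> R) (x y : Rbar) (a l t : R) : Prop :=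
  0 < l /\ open_itv x y (t / l) /\ rev_fun f a l t = 0.

Definition noncharacteristic (f : R -> R) (x y : Rbar) : Prop :=
  forall a l t, on_surface f x y a l t -> hgrad_norm (rev_fun f) a l t <> 0.

Definition const_distortion (q : R) (f : R -> R) (x y : Rbar) : Prop :=
  forall a l t, on_surface f x y a l t -> hgrad_norm (rev_fun f) a l t <> 0 ->
    distortion (rev_fun f) a l t = q.

(** A choice of the sign [+-] on the interval [(x, y)] that is constant on
    each connected piece of the subset [P] of the interval. *)
Definition sign_choice (x y : Rbar) (P : R -> Prop) (eps : R -> R) : Prop :=
  (forall r, eps r = 1 \/ eps r = -1) /\
  (forall r s, open_itv x y r -> open_itv x y s -> r <= s ->
     (forall z, r <= z <= s -> P z) -> eps r = eps s).

(** The point [r = 0] is outside the domain [1 / c - 1 < r ^ 2] when [c = 1],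
    but it is then a characteristic point of the (C^2) surface, over which
    [f] extends; this is why it is exempted below. *)
Definition zero_family (f : R -> R) (x y : Rbar) : Prop :=
  exists (c C : R) (eps : R -> R),
    0 < c /\
    sign_choice x y (fun r => 1 / c - 1 < r ^ 2) eps /\
    (forall r, open_itv x y r -> r <> 0 -> 1 / c - 1 < r ^ 2) /\
    (forall r, open_itv x y r ->
       f r = 1 / 2 * (eps r * sqrt (c * r ^ 2 + c - 1)
                      - eps r * atan (sqrt (c * r ^ 2 + c - 1))
                      + atan r) + C).

Definition radicand (q c1 s : R) : R :=
  - c1 ^ 2 + c1 * q * s - 1 / 4 * (q ^ 2 - 4) * s ^ 2 + 1.

Definition integrand (q c1 : R) (eps : R -> R) (s : R) : R :=
  s * ((c1 / s - q / 2) + eps s * sqrt (radicand q c1 s))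
  / ((s ^ 2 + 1) * (2 * c1 - q * s)).

(** The horizontal gradient of a member of this family has norm
    [2 * s / (2 * c1 - q * s)], hence the positivity requirement; where this
    quotient is negative the same integral has distortion [- q].  At [s = 0]
    the integrand is not meaningful, but the interval may contain [0] (then
    [c1 = 0] and the singularity is removable). *)
Definition nonzero_family (q : R) (f : R -> R) (x y : Rbar) : Prop :=
  exists (rho0 c1 C : R) (eps : R -> R),
    open_itv x y rho0 /\ rho0 <> 0 /\
    sign_choice x y (fun s => 0 < radicand q c1 s) eps /\
    (forall s, open_itv x y s -> 0 <= radicand q c1 s) /\
    (forall s, open_itv x y s -> s <> 0 -> 0 < s / (2 * c1 - q * s)) /\
    (forall r, open_itv x y r ->
       ex_RInt (integrand q c1 eps) rho0 r /\
       f r = RInt (integrand q c1 eps) rho0 r + C).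

(* Main.v *)
Require Import Defs.
From Stdlib Require Import Reals Ranalysis5 Lra Psatz.
From Coquelicot Require Import Coquelicot.
Open Scope R_scope.

(** Write p = f', let s = t / l be the profile variable, and let N be the norm
    of the horizontal gradient of [rev_fun f], so that
    N^2 = (2 s p)^2 + (1 - 2 p)^2.  The components of the unit normal,
    B = 2 s p / N along V and A = (1 - 2 p) / N along U, depend on s only, and
    the distortion collapses to Q = -2 (s A + B)' = -2 (s / N)'.  The condition
    Q = q therefore has the first integral s / N = c1 - q s / 2
    ([const_distortion_iff]).

    Together with N^2, this is a quadratic equation for p.  Completing the
    square with D = 2 (1 + s^2) p - 1 turns it into D^2 = (1 + s^2) N^2 - s^2
    ([discr_root_sqr]); inserting N gives D up to a sign, hence p, and f by
    integration.  The sign is that of D / s or D / N, which is continuous, so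
    the intermediate value theorem makes the sign constant wherever the
    expression under the root does not vanish ([sign_choice_sign_of]).

    A point is characteristic exactly when N = 0, which forces s = 0, and the
    first integral is only available on each side of such a point.

    If q = 0, then s / N is locally constant, and it cannot be so near a
    non-characteristic origin; thus the origin is characteristic whenever it
    lies in the interval.  There D / s extends continuously, because f is of
    class C^2, and so does (N / s)^2 = (1 + (D / s)^2) / (1 + s^2).  The
    constants found on the two sides coincide, and a single c describes the
    profile ([zero_family_of_first_integral]).

    If q <> 0, the statement is about non-characteristic intervals, on which
    g = D / N is continuous and g^2 is the radicand of the integral
    ([nonzero_family_of_first_integral]).  The converses differentiate the
    formula for f away from s = 0, recover N^2 from D^2, and reach s = 0 by
    continuity. *)

(** * Points of profile intervals *)

Lemma open_itv_locally (x y : Rbar) (r : R) :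
  open_itv x y r -> locally r (open_itv x y).
Proof.
  intros [Hx Hy].
  apply filter_and.
  - exact (open_Rbar_gt' r x Hx).
  - exact (open_Rbar_lt' r y Hy).
Qed.

Lemma open_itv_convex (x y : Rbar) (r s z : R) :
  open_itv x y r -> open_itv x y s -> r <= z <= s -> open_itv x y z.
Proof.
  intros [Hr _] [_ Hs] [H1 H2]; split.
  - apply Rbar_lt_le_trans with r; assumption.
  - apply Rbar_le_lt_trans with s; assumption.
Qed.

Lemma open_itv_between (x y : Rbar) (r s z : R) :
  open_itv x y r -> open_itv x y s -> Rmin r s <= z <= Rmax r s ->
  open_itv x y z.
Proof.
  intros Hr Hs. unfold Rmin, Rmax. destruct (Rle_dec r s); intros Hz.
  - now apply (open_itv_convex x y r s).
  - now apply (open_itv_convex x y s r).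
Qed.

Lemma open_itv_nonzero_point (x y : Rbar) :
  Rbar_lt x y -> exists r, open_itv x y r /\ r <> 0.
Proof.
  intros Hxy.
  assert (He : exists r, open_itv x y r).
  { unfold open_itv; destruct x as [x| |], y as [y| |]; simpl in *; try easy.
    - exists ((x + y) / 2); lra.
    - exists (x + 1); split; [lra | easy].
    - exists (y - 1); split; [easy | lra].
    - exists 0; easy. }
  destruct He as [r Hr].
  destruct (Req_dec r 0) as [-> | Hn]; [ | now exists r].
  destruct (open_itv_locally x y 0 Hr) as [d Hd].
  exists (d / 2); pose proof (cond_pos d); split; [ | lra].
  apply Hd. change (Rabs (d / 2 - 0) < d). rewrite Rabs_pos_eq; lra.
Qed.

Lemma C2_on_sub (f : R -> R) (x y x' y' : Rbar) :
  Rbar_le x x' -> Rbar_le y' y -> C2_on x y f -> C2_on x' y' f.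
Proof.
  intros Hx Hy Hf r [H1 H2]. apply Hf. split.
  - now apply Rbar_le_lt_trans with x'.
  - now apply Rbar_lt_le_trans with y'.
Qed.

Lemma locally_open_subinterval (x y : Rbar) (P : R -> Prop) (r : R) :
  open_itv x y r -> locally r P ->
  exists a b : R, a < r < b /\ Rbar_lt x a /\ Rbar_lt b y /\
    (forall z, a < z < b -> P z).
Proof.
  intros Hr HP.
  destruct (filter_and _ _ HP (open_itv_locally x y r Hr)) as [d Hd].
  pose proof (cond_pos d) as Hp.
  assert (Hd' : forall z, r - d < z < r + d -> P z /\ open_itv x y z).
  { intros z Hz. apply Hd. change (Rabs (z - r) < d). apply Rabs_def1; lra. }
  exists (r - d / 2), (r + d / 2). repeat split; try lra.
  - apply Hd'; lra.
  - apply Hd'; lra.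
  - intros z Hz; apply Hd'; lra.
Qed.

(** * Calculus with the origin as an exceptional point *)

Lemma locally_neq (r z : R) : r <> z -> locally r (fun s => s <> z).
Proof. intros H. apply (open_neq z). exact H. Qed.

Lemma continuous_pos_locally (g : R -> R) (r : R) :
  continuous g r -> 0 < g r -> locally r (fun z => 0 < g z).
Proof. intros Hc Hp. exact (Hc _ (open_gt 0 (g r) Hp)). Qed.

Lemma continuous_neq0_locally (g : R -> R) (r : R) :
  continuous g r -> g r <> 0 -> locally r (fun z => g z <> 0).
Proof. intros Hc Hp. exact (Hc _ (locally_neq (g r) 0 Hp)). Qed.

Lemma continuous_eq0_at_0 (F : R -> R) :
  continuous F 0 -> locally 0 (fun z => z <> 0 -> F z = 0) -> F 0 = 0.
Proof.
  intros Hc H0. destruct (Req_dec (F 0) 0) as [ | Hn]; [easy | exfalso].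
  destruct (filter_and _ _ H0 (continuous_neq0_locally F 0 Hc Hn)) as [d Hd].
  pose proof (cond_pos d) as Hp.
  destruct (Hd (d / 2)) as [H1 H2].
  - change (Rabs (d / 2 - 0) < d). rewrite Rabs_pos_eq; lra.
  - apply H2, H1. lra.
Qed.

Lemma continuous_slope_at_0 (F : R -> R) (l : R) :
  F 0 = 0 -> is_derive F 0 l ->
  continuous (fun r => if Req_EM_T r 0 then l else F r / r) 0.
Proof.
  intros HF Hd. apply filterlim_locally. intros e.
  apply is_derive_Reals in Hd.
  destruct (Hd e (cond_pos e)) as [d H]. exists d. intros z Hz.
  change (Rabs (z - 0) < d) in Hz. rewrite Rminus_0_r in Hz.
  change (Rabs ((if Req_EM_T z 0 then l else F z / z) -
                (if Req_EM_T 0 0 then l else F 0 / 0)) < e).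
  destruct (Req_EM_T 0 0) as [_ | ]; [ | easy].
  destruct (Req_EM_T z 0) as [_ | Hn].
  - rewrite Rminus_diag, Rabs_R0. apply cond_pos.
  - specialize (H z Hn Hz). now rewrite Rplus_0_l, HF, Rminus_0_r in H.
Qed.

(** The derivative need not exist at 0: the mean value theorem is applied on
    either side, and the two sides are joined by the value at 0. *)
Lemma constant_off_zero (x y : Rbar) (F : R -> R) :
  (forall r, open_itv x y r -> continuous F r) ->
  (forall r, open_itv x y r -> r <> 0 -> is_derive F r 0) ->
  forall r s, open_itv x y r -> open_itv x y s -> F r = F s.
Proof.
  intros Hc Hd.
  assert (Hside : forall r s, open_itv x y r -> open_itv x y s ->
            (0 <= r /\ 0 <= s \/ r <= 0 /\ s <= 0) -> F r = F s).
  { intros r s Hr Hs H0.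
    destruct (MVT_gen F r s (fun _ => 0)) as [c [_ Hmvt]].
    - intros z Hz. apply Hd.
      + apply (open_itv_between x y r s); trivial; lra.
      + revert Hz; unfold Rmin, Rmax; destruct (Rle_dec r s); lra.
    - intros z Hz. apply continuity_pt_filterlim, Hc.
      now apply (open_itv_between x y r s).
    - lra. }
  intros r s Hr Hs.
  destruct (Rle_dec 0 r) as [H1|H1]; destruct (Rle_dec 0 s) as [H2|H2];
    try (apply Hside; trivial; lra).
  - assert (H0 : open_itv x y 0) by (apply (open_itv_convex x y s r); trivial; lra).
    transitivity (F 0); apply Hside; trivial; lra.
  - assert (H0 : open_itv x y 0) by (apply (open_itv_convex x y r s); trivial; lra).
    transitivity (F 0); apply Hside; trivial; lra.
Qed.

(** The integrand of the family with non-zero distortion has no meaningful value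
    at 0: the integral is split there, and each part only involves the interior
    of its own side. *)
Lemma is_RInt_derive_off_zero (f k : R -> R) (x y : Rbar) (a b : R) :
  C2_on x y f -> open_itv x y a -> open_itv x y b ->
  (forall s, open_itv x y s -> s <> 0 -> k s = Derive f s) ->
  is_RInt k a b (f b - f a).
Proof.
  intros Hf Ha Hb Hk.
  assert (Hside : forall r s, open_itv x y r -> open_itv x y s ->
            (0 <= r /\ 0 <= s \/ r <= 0 /\ s <= 0) -> is_RInt k r s (f s - f r)).
  { intros r s Hr Hs H0.
    apply (is_RInt_ext (Derive f)).
    - intros z Hz. symmetry. apply Hk.
      + apply (open_itv_between x y r s); trivial; lra.
      + revert Hz; unfold Rmin, Rmax; destruct (Rle_dec r s); lra.
    - apply (is_RInt_derive f); intros z Hz;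
        apply (open_itv_between x y r s z Hr Hs) in Hz.
      + apply Derive_correct, Hf, Hz.
      + apply (ex_derive_continuous (Derive f)), Hf, Hz. }
  assert (Hvia0 : open_itv x y 0 -> is_RInt k a b (f b - f a)).
  { intros H0. replace (f b - f a) with ((f 0 - f a) + (f b - f 0)) by ring.
    apply (is_RInt_Chasles k a 0 b (f 0 - f a) (f b - f 0)); apply Hside; trivial;
      destruct (Rle_dec 0 a), (Rle_dec 0 b); lra. }
  destruct (Rle_dec 0 a) as [H1|H1]; destruct (Rle_dec 0 b) as [H2|H2];
    try (apply Hside; trivial; lra).
  - apply Hvia0, (open_itv_convex x y b a); trivial; lra.
  - apply Hvia0, (open_itv_convex x y a b); trivial; lra.
Qed.

(** * Distortion of a surface of revolution *)

Definition profile_norm (f : R -> R) (s : R) : R :=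
  sqrt ((2 * s * Derive f s) ^ 2 + (1 - 2 * Derive f s) ^ 2).

(** Solving (2 s p)^2 + (1 - 2 p)^2 = N^2 for p = f' by the quadratic formula gives
    p = (1 + root) / (2 (1 + s^2)), and this is that root with its sign. *)
Definition discr_root (f : R -> R) (s : R) : R :=
  2 * (1 + s ^ 2) * Derive f s - 1.

Lemma profile_norm_sqr (f : R -> R) (s : R) :
  profile_norm f s ^ 2 = (2 * s * Derive f s) ^ 2 + (1 - 2 * Derive f s) ^ 2.
Proof. unfold profile_norm. apply pow2_sqrt, Rplus_le_le_0_compat; apply pow2_ge_0. Qed.

Lemma discr_root_sqr (f : R -> R) (s : R) :
  discr_root f s ^ 2 = (1 + s ^ 2) * profile_norm f s ^ 2 - s ^ 2.
Proof. rewrite profile_norm_sqr. unfold discr_root. ring. Qed.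

Lemma profile_norm_eq0 (f : R -> R) (s : R) :
  profile_norm f s = 0 -> s = 0 /\ Derive f s = 1 / 2.
Proof.
  intros H. pose proof (profile_norm_sqr f s) as E. rewrite H in E.
  destruct (Rplus_sqr_eq_0 (2 * s * Derive f s) (1 - 2 * Derive f s)) as [H1 H2].
  { unfold Rsqr. lra. }
  assert (Hp : Derive f s = 1 / 2) by lra. rewrite Hp in H1. split; lra.
Qed.

Lemma V_rev_fun (f : R -> R) (a l t : R) :
  0 < l -> ex_derive f (t / l) ->
  V (rev_fun f) a l t = 2 * (t / l) * Derive f (t / l).
Proof.
  intros Hl Hf. unfold V, rev_fun.
  rewrite (is_derive_unique _ _ (Derive f (t / l) * (t / l ^ 2))).
  - field; lra.
  - auto_derive.
    + split; [easy | split; [lra | easy]].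
    + change (fun z => f z) with f; unfold Rdiv; field; lra.
Qed.

Lemma U_rev_fun (f : R -> R) (a l t : R) :
  0 < l -> ex_derive f (t / l) ->
  U (rev_fun f) a l t = 1 - 2 * Derive f (t / l).
Proof.
  intros Hl Hf. unfold U, rev_fun.
  rewrite (is_derive_unique (fun a' => a' - f (t / l)) _ 1)
    by (auto_derive; [easy | ring]).
  rewrite (is_derive_unique _ _ (- Derive f (t / l) / l)).
  - field; lra.
  - auto_derive; [easy | change (fun z => f z) with f; unfold Rdiv; field; lra].
Qed.

Lemma hgrad_norm_rev_fun (f : R -> R) (a l t : R) :
  0 < l -> ex_derive f (t / l) ->
  hgrad_norm (rev_fun f) a l t = profile_norm f (t / l).
Proof.
  intros Hl Hf. unfold hgrad_norm, profile_norm.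
  now rewrite V_rev_fun, U_rev_fun.
Qed.

Lemma ex_derive_profile_norm (f : R -> R) (r : R) :
  ex_derive (Derive f) r -> profile_norm f r <> 0 ->
  ex_derive (profile_norm f) r.
Proof.
  intros Hf HN. unfold profile_norm in HN |- *.
  assert (Hpos : 0 < (2 * r * Derive f r) ^ 2 + (1 - 2 * Derive f r) ^ 2).
  { apply Rnot_le_lt. intros H. apply HN, sqrt_neg_0, H. }
  revert Hf Hpos. generalize (Derive f); intros p Hp Hpos.
  auto_derive. repeat split; trivial.
Qed.

Lemma continuous_profile_norm (f : R -> R) (r : R) :
  ex_derive (Derive f) r -> continuous (profile_norm f) r.
Proof.
  intros Hf. unfold profile_norm.
  apply continuous_comp; [ | apply continuous_sqrt].
  apply (ex_derive_continuous (fun s => (2 * s * Derive f s) ^ 2 + (1 - 2 * Derive f s) ^ 2)).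
  revert Hf; generalize (Derive f); intros p Hp. auto_derive. easy.
Qed.

Lemma ex_derive_discr_root (f : R -> R) (r : R) :
  ex_derive (Derive f) r -> ex_derive (discr_root f) r.
Proof.
  unfold discr_root. generalize (Derive f); intros p Hp. auto_derive. easy.
Qed.

(** The distortion is -2 (s A + B)', where A and B are the components of the unit
    normal along U and V, and s A + B = s / N because the terms in f' cancel. *)
Lemma distortion_rev_fun (f : R -> R) (a l t : R) :
  0 < l -> locally (t / l) (ex_derive f) -> ex_derive (Derive f) (t / l) ->
  profile_norm f (t / l) <> 0 ->
  is_derive (fun s => s / profile_norm f s) (t / l)
    (- distortion (rev_fun f) a l t / 2).
Proof.
  intros Hl Hloc Hf HN.
  pose proof (ex_derive_profile_norm f _ Hf HN) as HdN.
  (* The horizontal unit normal has components A and B along U and V; both are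
     functions of t / l, along which V acts as -2 s d/ds and U as 2 d/ds. *)
  set (A := fun s => (1 - 2 * Derive f s) / profile_norm f s).
  set (B := fun s => 2 * s * Derive f s / profile_norm f s).
  assert (HA : ex_derive A (t / l)).
  { unfold A. revert Hf HN HdN; generalize (Derive f) (profile_norm f).
    intros p N ? ? ?. auto_derive. easy. }
  assert (HB : ex_derive B (t / l)).
  { unfold B. revert Hf HN HdN; generalize (Derive f) (profile_norm f).
    intros p N ? ? ?. auto_derive. easy. }
  assert (Hl_loc : locally l (fun l' => 0 < l' /\ ex_derive f (t / l'))).
  { apply filter_and; [exact (open_gt 0 l Hl) | ].
    assert (Hc : continuous (fun l' => t / l') l)
      by (apply (ex_derive_continuous (fun l' => t / l')); auto_derive; lra).
    exact (Hc _ Hloc). }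
  assert (Ht_loc : locally t (fun t' => ex_derive f (t' / l))).
  { assert (Hc : continuous (fun t' => t' / l) t)
      by (apply (ex_derive_continuous (fun t' => t' / l)); auto_derive; lra).
    exact (Hc _ Hloc). }
  pose proof (locally_singleton _ _ Hloc) as Hf1.
  assert (HQ : distortion (rev_fun f) a l t
    = - 2 * (t / l) * Derive A (t / l) - 2 * Derive B (t / l) - 2 * A (t / l)).
  { unfold distortion. unfold V at 1. unfold U at 2.
    rewrite (Derive_ext_loc (fun l' => U (rev_fun f) a l' t / hgrad_norm (rev_fun f) a l' t)
               (fun l' : R => A (t / l'))).
    2:{ revert Hl_loc; apply filter_imp; intros l' [? ?].
        now rewrite U_rev_fun, hgrad_norm_rev_fun. }
    rewrite (Derive_ext (fun a' => V (rev_fun f) a' l t / hgrad_norm (rev_fun f) a' l t)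
               (fun _ => B (t / l))).
    2:{ intros a'. now rewrite V_rev_fun, hgrad_norm_rev_fun. }
    rewrite (Derive_ext_loc (fun t' => V (rev_fun f) a l t' / hgrad_norm (rev_fun f) a l t')
               (fun t' : R => B (t' / l))).
    2:{ revert Ht_loc; apply filter_imp; intros t' ?.
        now rewrite V_rev_fun, hgrad_norm_rev_fun. }
    rewrite U_rev_fun, hgrad_norm_rev_fun, Derive_const by easy.
    assert (EA : Derive (fun l' : R => A (t / l')) l = - t / l ^ 2 * Derive A (t / l)).
    { apply is_derive_unique. clearbody A.
      auto_derive; [split; [easy | split; [lra | easy]] | ].
      change (fun z => A z) with A. unfold Rdiv; field; lra. }
    assert (EB : Derive (fun t' : R => B (t' / l)) t = Derive B (t / l) / l).
    { apply is_derive_unique. clearbody B. auto_derive; [easy | ].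
      change (fun z => B z) with B. unfold Rdiv; field; lra. }
    rewrite EA, EB.
    change ((1 - 2 * Derive f (t / l)) / profile_norm f (t / l)) with (A (t / l)).
    field; lra. }
  apply (is_derive_ext (fun s => s * A s + B s)).
  { intros s. change (s * A s + B s = s / profile_norm f s).
    unfold A, B, Rdiv. ring. }
  rewrite HQ. clearbody A B. auto_derive; [easy | ].
  change (fun z => A z) with A; change (fun z => B z) with B. field; lra.
Qed.

(** The distortion depends on the profile variable alone, so it suffices to look
    at the section l = 1. *)
Lemma const_distortion_iff (f : R -> R) (x y : Rbar) (q : R) :
  C2_on x y f ->
  (const_distortion q f x y <->
   forall r, open_itv x y r -> profile_norm f r <> 0 ->
     is_derive (fun s => s / profile_norm f s) r (- q / 2)).
Proof.
  intros Hf.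
  assert (Hloc : forall r, open_itv x y r -> locally r (ex_derive f)).
  { intros r Hr. generalize (open_itv_locally x y r Hr).
    apply filter_imp; intros z Hz; apply Hf, Hz. }
  split.
  - intros H r Hr HN.
    assert (E : r / 1 = r) by field.
    rewrite <- (H (f r) 1 r).
    + pose proof (distortion_rev_fun f (f r) 1 r Rlt_0_1) as D.
      rewrite E in D. apply D; trivial; [now apply Hloc | apply Hf, Hr].
    + split; [lra | split; [now rewrite E | unfold rev_fun; rewrite E; ring]].
    + rewrite hgrad_norm_rev_fun; [now rewrite E | lra | rewrite E; apply Hf, Hr].
  - intros H a l t (Hl & Hr & _) HN.
    rewrite hgrad_norm_rev_fun in HN; [ | easy | apply Hf, Hr].
    pose proof (distortion_rev_fun f a l t Hl (Hloc _ Hr) (proj1 (proj2 (Hf _ Hr))) HN) as D.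
    apply is_derive_unique in D.
    rewrite (is_derive_unique _ _ _ (H _ Hr HN)) in D. lra.
Qed.

Lemma noncharacteristic_iff (f : R -> R) (x y : Rbar) :
  (forall r, open_itv x y r -> ex_derive f r) ->
  (noncharacteristic f x y <->
   forall r, open_itv x y r -> profile_norm f r <> 0).
Proof.
  intros Hf; split.
  - intros H r Hr. assert (E : r / 1 = r) by field.
    specialize (H (f r) 1 r).
    rewrite hgrad_norm_rev_fun, E in H; [ | lra | rewrite E; now apply Hf].
    apply H. split; [lra | split; [now rewrite E | unfold rev_fun; rewrite E; ring]].
  - intros H a l t (Hl & Hr & _).
    rewrite hgrad_norm_rev_fun; auto.
Qed.

(** * Sign choices and square roots *)

Definition sign_of (g : R -> R) (r : R) : R := if Rle_dec 0 (g r) then 1 else -1.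

Lemma sign_of_sqrt_sqr (g : R -> R) (r : R) :
  sign_of g r * sqrt (g r ^ 2) = g r.
Proof.
  replace (g r ^ 2) with (Rsqr (g r)) by (unfold Rsqr; ring).
  rewrite sqrt_Rsqr_abs. unfold sign_of. destruct (Rle_dec 0 (g r)).
  - rewrite Rabs_pos_eq; lra.
  - rewrite Rabs_left; lra.
Qed.

(** By the intermediate value theorem, a continuous function cannot change sign
    along a segment without a zero. *)
Lemma sign_choice_sign_of (x y : Rbar) (P : R -> Prop) (g : R -> R) :
  (forall r, open_itv x y r -> continuous g r) ->
  (forall r, open_itv x y r -> P r -> g r <> 0) ->
  sign_choice x y P (sign_of g).
Proof.
  intros Hc Hn; split.
  - intros r; unfold sign_of; destruct (Rle_dec 0 (g r)); auto.
  - intros r s Hr Hs Hrs HP.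
    assert (Hz : forall z, r <= z <= s -> g z <> 0).
    { intros z Hz. apply Hn; [ | now apply HP].
      now apply (open_itv_convex x y r s). }
    assert (Hcz : forall z, r <= z <= s -> continuity_pt g z).
    { intros z Hrz. apply continuity_pt_filterlim, Hc.
      now apply (open_itv_convex x y r s). }
    pose proof (Hz r ltac:(lra)) as Hgr. pose proof (Hz s ltac:(lra)) as Hgs.
    destruct (Req_dec r s) as [-> | Hne]; [reflexivity | ].
    unfold sign_of; destruct (Rle_dec 0 (g r)), (Rle_dec 0 (g s)); trivial; exfalso.
    + destruct (IVT_interv (fun z => - g z) r s) as [z [Hrz Hgz]]; try lra.
      * intros a Ha. apply continuity_pt_opp. now apply Hcz.
      * apply (Hz z Hrz); lra.
    + destruct (IVT_interv g r s) as [z [Hrz Hgz]]; try lra; trivial.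
      exact (Hz z Hrz Hgz).
Qed.

Lemma sign_choice_locally (x y : Rbar) (P : R -> Prop) (eps : R -> R) (r : R) :
  sign_choice x y P eps -> open_itv x y r -> locally r P ->
  locally r (fun z => eps z = eps r).
Proof.
  intros [_ He] Hr HP.
  destruct (filter_and _ _ HP (open_itv_locally x y r Hr)) as [d Hd].
  exists d. intros z Hz.
  assert (Hseg : forall t, Rmin z r <= t <= Rmax z r -> P t /\ open_itv x y t).
  { intros t Ht. apply Hd. change (Rabs (t - r) < d). change (Rabs (z - r) < d) in Hz.
    revert Ht Hz. unfold Rmin, Rmax.
    destruct (Rle_dec z r); intros Ht Hz; apply Rabs_def2 in Hz; apply Rabs_def1; lra. }
  assert (Hz' : open_itv x y z) by (apply Hd, Hz).
  destruct (Rle_dec z r) as [Hle | Hle].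
  - apply He; trivial. intros t Ht. apply Hseg.
    rewrite Rmin_left, Rmax_right; lra.
  - symmetry. apply He; trivial; [lra | ]. intros t Ht. apply Hseg.
    rewrite Rmin_right, Rmax_left; lra.
Qed.

Lemma sign_choice_abs (x y : Rbar) (P : R -> Prop) (eps : R -> R) (r a : R) :
  sign_choice x y P eps -> Rabs (eps r * a) = Rabs a.
Proof.
  intros [He _]. rewrite Rabs_mult.
  destruct (He r) as [-> | ->]; [rewrite Rabs_R1 | rewrite Rabs_left by lra]; ring.
Qed.

Lemma sign_choice_sqr (x y : Rbar) (P : R -> Prop) (eps : R -> R) (r : R) :
  sign_choice x y P eps -> eps r ^ 2 = 1.
Proof. intros [He _]. destruct (He r) as [-> | ->]; ring. Qed.

(** Where the radicand is positive the sign is locally constant; where it is not,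
    both signs of the root tend to 0. *)
Lemma continuous_signed_sqrt (x y : Rbar) (w eps : R -> R) (r : R) :
  sign_choice x y (fun s => 0 < w s) eps -> open_itv x y r -> continuous w r ->
  continuous (fun s => eps s * sqrt (w s)) r.
Proof.
  intros He Hr Hw.
  assert (Hsq : continuous (fun s => sqrt (w s)) r)
    by (apply continuous_comp; [easy | apply continuous_sqrt]).
  destruct (Rlt_dec 0 (w r)) as [Hpos | Hneg].
  - apply (continuous_ext_loc _ (fun s => eps r * sqrt (w s))).
    + generalize (sign_choice_locally x y _ eps r He Hr (continuous_pos_locally w r Hw Hpos)).
      apply filter_imp. now intros z ->.
    + exact (continuous_scal_r (K := R_AbsRing) (V := R_NormedModule) (eps r) _ r Hsq).
  - assert (H0 : sqrt (w r) = 0) by (apply sqrt_neg_0; lra).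
    apply filterlim_locally. intros e.
    generalize (proj1 (filterlim_locally _ _) Hsq e). apply filter_imp. intros z.
    change (Rabs (sqrt (w z) - sqrt (w r)) < e ->
            Rabs (eps z * sqrt (w z) - eps r * sqrt (w r)) < e).
    rewrite H0, Rmult_0_r, !Rminus_0_r, (sign_choice_abs _ _ _ _ _ _ He). easy.
Qed.

(** * Vanishing distortion *)

Lemma root_domain (c r : R) :
  0 < c -> 1 / c - 1 < r ^ 2 <-> 0 < c * r ^ 2 + c - 1.
Proof.
  intros Hc.
  replace (c * r ^ 2 + c - 1) with (c * (r ^ 2 - (1 / c - 1))) by (field; lra).
  split; intros H.
  - apply Rmult_lt_0_compat; lra.
  - apply (Rmult_lt_reg_l c); lra.
Qed.

(** Integrating the equation: the slope quotient D / r is followed through the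
    origin, so that one constant c and one constant C serve both sides. *)
Lemma zero_family_of_first_integral (f : R -> R) (x y : Rbar) :
  Rbar_lt x y -> C2_on x y f ->
  (forall r, open_itv x y r -> profile_norm f r <> 0 ->
     is_derive (fun s => s / profile_norm f s) r 0) ->
  zero_family f x y.
Proof.
  intros Hxy Hf HQ.
  set (N := profile_norm f) in *. set (D := discr_root f).
  assert (HN0 : open_itv x y 0 -> N 0 = 0).
  { intros H0. destruct (Req_dec (N 0) 0) as [E | E]; [easy | exfalso].
    assert (HdN : ex_derive N 0) by (apply ex_derive_profile_norm; [apply Hf, H0 | easy]).
    (* Were the origin non-characteristic, s / N s would have slope 1 / N 0
       there. *)
    assert (H1 : is_derive (fun s => s / N s) 0 (/ N 0)).
    { clearbody N. auto_derive; [easy | field; easy]. }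
    apply is_derive_unique in H1. rewrite (is_derive_unique _ _ _ (HQ 0 H0 E)) in H1.
    now apply (Rinv_neq_0_compat (N 0)). }
  assert (HN : forall r, r <> 0 -> N r <> 0).
  { intros r Hr E. now destruct (profile_norm_eq0 f r E). }
  assert (HdD : forall r, open_itv x y r -> ex_derive D r)
    by (intros r Hr; apply ex_derive_discr_root, Hf, Hr).
  (* The quotient D r / r is the square root, with its sign, of the family; the
     value at 0 is the only continuous one, since D 0 = 0 at a characteristic
     point. *)
  set (g := fun r => if Req_EM_T r 0 then Derive D 0 else D r / r).
  assert (Hg1 : forall r, r <> 0 -> g r = D r / r).
  { intros r Hr. unfold g. now destruct (Req_EM_T r 0). }
  assert (Hdg : forall r, open_itv x y r -> r <> 0 -> ex_derive g r).
  { intros r Hr Hn. apply (ex_derive_ext_loc (fun z => D z / z)).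
    - generalize (locally_neq r 0 Hn). apply filter_imp. intros z Hz. now rewrite Hg1.
    - specialize (HdD r Hr). clearbody D. auto_derive. easy. }
  assert (Hg : forall r, open_itv x y r -> continuous g r).
  { intros r Hr. destruct (Req_dec r 0) as [-> | Hn].
    - apply continuous_slope_at_0.
      + destruct (profile_norm_eq0 f 0 (HN0 Hr)) as [_ E].
        unfold D, discr_root. rewrite E. field.
      + now apply Derive_correct, HdD.
    - now apply (ex_derive_continuous g), Hdg. }
  (* M is (N r / r)^2 continued across the origin: it is continuous there because
     it is written in terms of g, so the constants on both sides agree. *)
  set (M := fun r => (1 + g r ^ 2) / (1 + r ^ 2)).
  assert (Hpos : forall r, 0 < 1 + r ^ 2) by (intros r; nra).
  assert (HM1 : forall r, r <> 0 -> M r = / (r / N r) ^ 2).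
  { intros r Hn. unfold M. rewrite Hg1 by easy.
    replace ((D r / r) ^ 2) with (D r ^ 2 / r ^ 2) by (field; easy).
    unfold D; rewrite discr_root_sqr. fold N.
    specialize (Hpos r). field; repeat split; auto; lra. }
  assert (HM : forall r s, open_itv x y r -> open_itv x y s -> M r = M s).
  { apply constant_off_zero.
    - intros r Hr. specialize (Hg r Hr).
      assert (Hr2 : continuous (fun z => / (1 + z ^ 2)) r).
      { apply (ex_derive_continuous (fun z => / (1 + z ^ 2))). specialize (Hpos r).
        auto_derive. lra. }
      assert (Hg2 : continuous (fun z => 1 + g z ^ 2) r).
      { apply (continuous_comp g (fun v => 1 + v ^ 2)); [easy | ].
        apply (ex_derive_continuous (fun v => 1 + v ^ 2)). now auto_derive. }
      exact (continuous_mult _ _ r Hg2 Hr2).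
    - intros r Hr Hn.
      apply (is_derive_ext_loc (fun z => / (z / N z) ^ 2)).
      + generalize (locally_neq r 0 Hn). apply filter_imp. intros z Hz.
        symmetry; now apply HM1.
      + assert (Hh : r / N r <> 0)
          by (unfold Rdiv; apply Rmult_integral_contrapositive_currified;
              [easy | now apply Rinv_neq_0_compat, HN]).
        rewrite <- (Rmult_0_l (- (2 * (r / N r)) / (r / N r) ^ 4)).
        apply (is_derive_comp (fun v => / v ^ 2) (fun z => z / N z));
          [ | now apply HQ, HN].
        revert Hh; generalize (r / N r); intros h Hh.
        auto_derive; [nra | field; easy]. }
  destruct (open_itv_nonzero_point x y Hxy) as [r1 [Hr1 Hn1]].
  set (c := M r1).
  assert (Hc : 0 < c).
  { unfold c, M. apply Rdiv_lt_0_compat; [nra | apply Hpos]. }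
  assert (Hw : forall r, open_itv x y r -> g r ^ 2 = c * r ^ 2 + c - 1).
  { intros r Hr. unfold c. rewrite (HM r1 r Hr1 Hr). unfold M.
    field. specialize (Hpos r); lra. }
  clearbody c. clear HM HM1 M.
  assert (Hwpos : forall r, open_itv x y r -> r <> 0 -> 0 < c * r ^ 2 + c - 1).
  { (* The left side is the square of g, hence non-negative on a whole
       neighbourhood of r; a zero at r <> 0 would force a negative value at
       points slightly closer to the origin. *)
    intros r Hr Hn. destruct (Rlt_dec 0 (c * r ^ 2 + c - 1)) as [ | Hle]; [easy | exfalso].
    destruct (open_itv_locally x y r Hr) as [d Hd].
    pose proof (cond_pos d) as Hdp.
    assert (Hz : exists z, open_itv x y z /\ z ^ 2 < r ^ 2).
    { destruct (Rlt_dec 0 r).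
      - exists (r - Rmin (d / 2) r). split.
        + apply Hd. change (Rabs (r - Rmin (d / 2) r - r) < d).
          replace (r - Rmin (d / 2) r - r) with (- Rmin (d / 2) r) by ring.
          rewrite Rabs_Ropp. unfold Rmin; destruct (Rle_dec (d / 2) r);
            rewrite Rabs_pos_eq; lra.
        + unfold Rmin; destruct (Rle_dec (d / 2) r); nra.
      - exists (r + Rmin (d / 2) (- r)). split.
        + apply Hd. change (Rabs (r + Rmin (d / 2) (- r) - r) < d).
          replace (r + Rmin (d / 2) (- r) - r) with (Rmin (d / 2) (- r)) by ring.
          unfold Rmin; destruct (Rle_dec (d / 2) (- r));
            rewrite Rabs_pos_eq; lra.
        + unfold Rmin; destruct (Rle_dec (d / 2) (- r)); nra. }
    destruct Hz as [z [Hz Hzr]].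
    pose proof (Hw z Hz). pose proof (pow2_ge_0 (g z)). nra. }
  (* As atan is odd, the sign in the formula of the family can be absorbed into
     g, which makes F continuous also where the sign may change. *)
  set (F := fun r => f r - 1 / 2 * (g r - atan (g r) + atan r)).
  assert (HF : forall r s, open_itv x y r -> open_itv x y s -> F r = F s).
  { apply constant_off_zero.
    - intros r Hr.
      assert (H1 : continuous (fun r => g r - atan (g r)) r).
      { apply (continuous_comp g (fun v => v - atan v)); [now apply Hg | ].
        apply (ex_derive_continuous (fun v => v - atan v)). now auto_derive. }
      assert (H2 : continuous (fun r => f r - 1 / 2 * atan r) r).
      { apply (ex_derive_continuous (fun r => f r - 1 / 2 * atan r)).
        auto_derive. exact (proj1 (Hf r Hr)). }
      assert (H3 : continuous (fun r => 1 / 2 * (g r - atan (g r))) r)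
        by exact (continuous_scal_r (K := R_AbsRing) (V := R_NormedModule) (1 / 2) _ r H1).
      apply (continuous_ext (fun r => (f r - 1 / 2 * atan r) - 1 / 2 * (g r - atan (g r)))).
      + intros z. unfold F. change ((f z - 1 / 2 * atan z) - 1 / 2 * (g z - atan (g z)) =
          f z - 1 / 2 * (g z - atan (g z) + atan z)). ring.
      + exact (continuous_minus _ _ r H2 H3).
    - intros r Hr Hn.
      pose proof (Hdg r Hr Hn) as Hdgr.
      (* Differentiate Hw. *)
      assert (Hgg : g r * Derive g r = c * r).
      { assert (H1 : is_derive (fun z => g z ^ 2) r (2 * g r * Derive g r))
          by (clearbody g; auto_derive; [easy | change (fun z => g z) with g; ring]).
        assert (H2 : is_derive (fun z => g z ^ 2) r (2 * c * r)).
        { apply (is_derive_ext_loc (fun z => c * z ^ 2 + c - 1)).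
          - generalize (open_itv_locally x y r Hr). apply filter_imp.
            intros z Hz. symmetry; now apply Hw.
          - auto_derive; [easy | ring]. }
        apply is_derive_unique in H1. rewrite (is_derive_unique _ _ _ H2) in H1. lra. }
      assert (HD : 2 * (1 + r ^ 2) * Derive f r - 1 = r * g r).
      { change (D r = r * g r). rewrite Hg1 by easy. field; easy. }
      assert (Hfr : ex_derive f r) by apply Hf, Hr.
      specialize (Hw r Hr). specialize (Hpos r).
      assert (Hp : Derive f r = (1 + r * g r) / (2 * (1 + r ^ 2))).
      { apply (Rmult_eq_reg_l (2 * (1 + r ^ 2))); [ | lra].
        replace (2 * (1 + r ^ 2) * Derive f r) with (1 + r * g r) by lra. field; lra. }
      unfold F. clearbody g. clear F D Hg1 HdD HD HQ HN HN0 N Hdg Hg.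
      auto_derive; [easy | ].
      change (fun z => g z) with g; change (fun z => f z) with f.
      rewrite Hp.
      assert (Hg2 : 1 + g r ^ 2 = c * (1 + r ^ 2)) by lra.
      replace (/ (1 + g r * (g r * 1))) with (/ (c * (1 + r ^ 2))) by (f_equal; lra).
      replace (/ (1 + r * (r * 1))) with (/ (1 + r ^ 2)) by (f_equal; ring).
      assert (Hk : Derive g r - Derive g r * / (c * (1 + r ^ 2)) = r * g r / (1 + r ^ 2)).
      { transitivity (Derive g r * (c * (1 + r ^ 2) - 1) / (c * (1 + r ^ 2))).
        { field. split; lra. }
        rewrite <- Hg2.
        replace (Derive g r * (1 + g r ^ 2 - 1)) with (g r * (g r * Derive g r)) by ring.
        rewrite Hgg, Hg2. field. split; lra. }
      transitivity ((1 + r * g r) / (2 * (1 + r ^ 2))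
        - 1 / 2 * ((Derive g r - Derive g r * / (c * (1 + r ^ 2))) + / (1 + r ^ 2)));
        [ring | rewrite Hk; field; lra]. }
  exists c, (F r1), (sign_of g). repeat split.
  - easy.
  - intros r; unfold sign_of; destruct (Rle_dec 0 (g r)); auto.
  - apply (sign_choice_sign_of x y); [easy | ].
    intros r Hr HP E. specialize (Hw r Hr). rewrite E in Hw.
    apply (root_domain c r Hc) in HP. lra.
  - intros r Hr Hn. now apply root_domain, Hwpos.
  - intros r Hr. rewrite <- (HF r r1 Hr Hr1). unfold F.
    rewrite <- (Hw r Hr). rewrite sign_of_sqrt_sqr.
    replace (sign_of g r * atan (sqrt (g r ^ 2))) with (atan (g r)); [field | ].
    rewrite <- (sign_of_sqrt_sqr g r) at 1. unfold sign_of.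
    destruct (Rle_dec 0 (g r)).
    + now rewrite !Rmult_1_l.
    + replace (-1 * sqrt (g r ^ 2)) with (- sqrt (g r ^ 2)) by ring.
      rewrite atan_opp. ring.
Qed.

(** Differentiation of the closed formula, with the sign frozen near the point. *)
Lemma discr_root_zero_family (f : R -> R) (x y : Rbar) (c C : R) (eps : R -> R) :
  0 < c ->
  sign_choice x y (fun r => 1 / c - 1 < r ^ 2) eps ->
  (forall r, open_itv x y r -> r <> 0 -> 1 / c - 1 < r ^ 2) ->
  (forall r, open_itv x y r ->
     f r = 1 / 2 * (eps r * sqrt (c * r ^ 2 + c - 1)
                    - eps r * atan (sqrt (c * r ^ 2 + c - 1))
                    + atan r) + C) ->
  forall r, open_itv x y r -> r <> 0 ->
    discr_root f r = r * (eps r * sqrt (c * r ^ 2 + c - 1)).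
Proof.
  intros Hc He Hdom Hfr r Hr Hn.
  assert (Hw : 0 < c * r ^ 2 + c - 1) by now apply root_domain, Hdom.
  assert (Hp : 0 < 1 + r ^ 2) by nra.
  set (k := eps r).
  assert (Hd : is_derive f r
            ((1 + r * (k * sqrt (c * r ^ 2 + c - 1))) / (2 * (1 + r ^ 2)))).
  { apply (is_derive_ext_loc (fun z => 1 / 2 * (k * sqrt (c * z ^ 2 + c - 1)
                    - k * atan (sqrt (c * z ^ 2 + c - 1)) + atan z) + C)).
    - assert (Hl : locally r (fun z => eps z = eps r)).
      { apply (sign_choice_locally x y _ eps r He Hr).
        generalize (filter_and _ _ (open_itv_locally x y r Hr) (locally_neq r 0 Hn)).
        apply filter_imp. intros z [? ?]; auto. }
      generalize (filter_and _ _ Hl (open_itv_locally x y r Hr)).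
      apply filter_imp. intros z [Hz1 Hz2]. rewrite (Hfr z Hz2), Hz1. reflexivity.
    - pose proof (sqrt_lt_R0 _ Hw) as Hs0.
      pose proof (sqrt_sqrt _ (Rlt_le _ _ Hw)) as Hs.
      auto_derive.
      + replace (c * (r * (r * 1)) + c + - (1)) with (c * r ^ 2 + c - 1) by ring.
        repeat split; lra.
      + replace (c * (r * (r * 1)) + c + - (1)) with (c * r ^ 2 + c - 1) by ring.
        set (w := sqrt (c * r ^ 2 + c - 1)) in *.
        replace (1 + w * (w * 1)) with (c * (1 + r ^ 2)) by lra.
        replace (1 + r * (r * 1)) with (1 + r ^ 2) by ring.
        assert (Hk : 1 - / (c * (1 + r ^ 2)) = w * w / (c * (1 + r ^ 2)))
          by (rewrite Hs; field; lra).
        transitivity (1 / 2 * (k * c * r / w * (1 - / (c * (1 + r ^ 2))) + / (1 + r ^ 2)));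
          [field; lra | rewrite Hk; field; lra]. }
  unfold discr_root. rewrite (is_derive_unique _ _ _ Hd). field. lra.
Qed.

(** The formula gives N^2 = c r^2 off the origin, so (r / N)^2 = 1 / c is constant
    and r / N, which does not vanish, has derivative 0. *)
Lemma first_integral_of_zero_family (f : R -> R) (x y : Rbar) :
  C2_on x y f -> zero_family f x y ->
  forall r, open_itv x y r -> profile_norm f r <> 0 ->
    is_derive (fun s => s / profile_norm f s) r 0.
Proof.
  intros Hf (c & C & eps & Hc & He & Hdom & Hfr) r Hr HNr.
  assert (HN2 : forall z, open_itv x y z -> z <> 0 -> profile_norm f z ^ 2 = c * z ^ 2).
  { intros z Hz Hn.
    pose proof (discr_root_zero_family f x y c C eps Hc He Hdom Hfr z Hz Hn) as HD.
    pose proof (discr_root_sqr f z) as HD2. rewrite HD in HD2.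
    assert (Hw : 0 < c * z ^ 2 + c - 1) by now apply root_domain, Hdom.
    replace ((z * (eps z * sqrt (c * z ^ 2 + c - 1))) ^ 2)
      with (z ^ 2 * (eps z ^ 2 * sqrt (c * z ^ 2 + c - 1) ^ 2)) in HD2 by ring.
    rewrite (sign_choice_sqr _ _ _ _ _ He), pow2_sqrt in HD2 by lra.
    apply (Rmult_eq_reg_l (1 + z ^ 2)); nra. }
  assert (HcN : continuous (profile_norm f) r)
    by apply continuous_profile_norm, Hf, Hr.
  assert (Hloc : locally r (fun z => open_itv x y z /\ profile_norm f z <> 0))
    by (apply filter_and; [now apply open_itv_locally | now apply continuous_neq0_locally]).
  assert (Hn : r <> 0).
  { (* By continuity N 0 = 0: over the origin the surface is characteristic. *)
    intros ->. apply HNr.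
    assert (H0 : profile_norm f 0 ^ 2 - c * 0 ^ 2 = 0).
    { apply (continuous_eq0_at_0 (fun z => profile_norm f z ^ 2 - c * z ^ 2)).
      - assert (HdN : ex_derive (profile_norm f) 0)
          by (apply ex_derive_profile_norm; [apply Hf, Hr | easy]).
        revert HdN. generalize (profile_norm f). intros N HdN.
        apply (ex_derive_continuous (fun z => N z ^ 2 - c * z ^ 2)). auto_derive. easy.
      - generalize (open_itv_locally x y 0 Hr). apply filter_imp.
        intros z Hz Hzn. rewrite HN2 by easy. ring. }
    nra. }
  set (h := fun s => s / profile_norm f s).
  assert (Hdh : ex_derive h r).
  { assert (ex_derive (profile_norm f) r) by (apply ex_derive_profile_norm; [apply Hf, Hr | easy]).
    unfold h. revert HNr H. generalize (profile_norm f). intros N ? ?. auto_derive. easy. }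
  assert (H1 : is_derive (fun z => h z ^ 2) r (2 * h r * Derive h r))
    by (clearbody h; auto_derive; [easy | change (fun z => h z) with h; ring]).
  assert (H2 : is_derive (fun z => h z ^ 2) r 0).
  { apply (is_derive_ext_loc (fun _ => / c)).
    - generalize (filter_and _ _ Hloc (locally_neq r 0 Hn)). apply filter_imp.
      intros z [[Hz HNz] Hzn]. change (/ c = (z / profile_norm f z) ^ 2).
      replace ((z / profile_norm f z) ^ 2) with (z ^ 2 / profile_norm f z ^ 2) by (field; easy).
      rewrite HN2 by easy. field. split; [easy | lra].
    - auto_derive; easy. }
  apply is_derive_unique in H1. rewrite (is_derive_unique _ _ _ H2) in H1.
  assert (Hh : h r <> 0)
    by (unfold h, Rdiv; apply Rmult_integral_contrapositive_currified;
        [easy | now apply Rinv_neq_0_compat]).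
  replace 0 with (Derive h r) by nra.
  now apply Derive_correct.
Qed.

(** * Constant non-zero distortion *)

Lemma continuous_radicand (q c1 r : R) : continuous (radicand q c1) r.
Proof.
  apply (ex_derive_continuous (radicand q c1)). unfold radicand. now auto_derive.
Qed.

(** On a non-characteristic interval D / N is continuous, and by the first
    integral its square is the radicand; its sign is the sign of the family. *)
Lemma nonzero_family_of_first_integral (f : R -> R) (x y : Rbar) (q : R) :
  Rbar_lt x y -> C2_on x y f ->
  (forall r, open_itv x y r -> profile_norm f r <> 0) ->
  (forall r, open_itv x y r -> is_derive (fun s => s / profile_norm f s) r (- q / 2)) ->
  nonzero_family q f x y.
Proof.
  intros Hxy Hf HN HQ.
  destruct (open_itv_nonzero_point x y Hxy) as [r1 [Hr1 Hn1]].
  set (N := profile_norm f) in *. set (D := discr_root f).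
  set (F := fun r => r / N r + q / 2 * r).
  assert (HdF : forall r, open_itv x y r -> is_derive F r 0).
  { intros r Hr. unfold F. replace 0 with (- q / 2 + q / 2) by field.
    apply (is_derive_plus (fun s => s / N s) (fun s => q / 2 * s)); [now apply HQ | ].
    auto_derive; [easy | ring]. }
  assert (HF : forall r s, open_itv x y r -> open_itv x y s -> F r = F s).
  { apply constant_off_zero.
    - intros r Hr. apply (ex_derive_continuous F). exists 0. now apply HdF.
    - intros r Hr _. now apply HdF. }
  set (c1 := F r1).
  assert (Hh : forall r, open_itv x y r -> 2 * c1 - q * r = 2 * (r / N r)).
  { intros r Hr. unfold c1. rewrite (HF r1 r Hr1 Hr). unfold F. field. now apply HN. }
  clearbody c1. clear HF HdF F.
  (* The signed square root of the integrand. *)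
  set (g := fun s => D s / N s).
  assert (Hg : forall r, open_itv x y r -> continuous g r).
  { intros r Hr.
    assert (HdN : ex_derive N r) by (apply ex_derive_profile_norm; [apply Hf, Hr | now apply HN]).
    assert (HdD : ex_derive D r) by (apply ex_derive_discr_root, Hf, Hr).
    specialize (HN r Hr). unfold g. clearbody N D.
    apply (ex_derive_continuous (fun s => D s / N s)). auto_derive. easy. }
  assert (Hg2 : forall r, open_itv x y r -> g r ^ 2 = radicand q c1 r).
  { intros r Hr. unfold g.
    replace ((D r / N r) ^ 2) with (D r ^ 2 / N r ^ 2) by (field; now apply HN).
    unfold D. rewrite discr_root_sqr. fold N.
    transitivity (1 + r ^ 2 - (r / N r) ^ 2); [field; now apply HN | ].
    replace (r / N r) with ((2 * c1 - q * r) / 2) by (rewrite Hh by easy; field; now apply HN).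
    unfold radicand. field. }
  assert (HRI : forall r, open_itv x y r ->
            is_RInt (integrand q c1 (sign_of g)) r1 r (f r - f r1)).
  { intros r Hr. apply (is_RInt_derive_off_zero f _ x y); trivial.
    intros s Hs Hn. unfold integrand.
    rewrite <- (Hg2 s Hs), sign_of_sqrt_sqr.
    assert (Hp : 0 < s ^ 2 + 1) by nra.
    (* With the first integral, the integrand becomes
       (1 + D s) / (2 * (s ^ 2 + 1)). *)
    replace (c1 / s - q / 2) with (/ N s).
    2:{ transitivity ((2 * c1 - q * s) / (2 * s)); [rewrite Hh by easy | ]; field;
          try split; trivial; now apply HN. }
    rewrite Hh by easy. unfold g, D, discr_root. field.
    repeat split; trivial; [now apply HN | lra]. }
  exists r1, c1, (f r1), (sign_of g). repeat split.
  - apply Hr1.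
  - apply Hr1.
  - easy.
  - intros r; unfold sign_of; destruct (Rle_dec 0 (g r)); auto.
  - apply (sign_choice_sign_of x y); [easy | ].
    intros r Hr HP E. rewrite <- (Hg2 r Hr), E in HP. lra.
  - intros s Hs. rewrite <- Hg2 by easy. apply pow2_ge_0.
  - intros s Hs Hn. rewrite Hh by easy.
    replace (s / (2 * (s / N s))) with (N s / 2) by (field; split; trivial; now apply HN).
    assert (0 <= N s) by apply sqrt_pos. specialize (HN s Hs). lra.
  - eexists. now apply HRI.
  - rewrite (is_RInt_unique _ _ _ _ (HRI r ltac:(easy))). ring.
Qed.

(** The integrand is continuous off 0 even where the radicand vanishes and the
    sign is arbitrary. *)
Lemma is_derive_nonzero_family (q : R) (f : R -> R) (x y : Rbar)
  (rho0 c1 C : R) (eps : R -> R) :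
  sign_choice x y (fun s => 0 < radicand q c1 s) eps ->
  (forall r, open_itv x y r ->
     ex_RInt (integrand q c1 eps) rho0 r /\
     f r = RInt (integrand q c1 eps) rho0 r + C) ->
  forall r, open_itv x y r -> r <> 0 -> 2 * c1 - q * r <> 0 ->
    is_derive f r (integrand q c1 eps r).
Proof.
  intros He Hfr r Hr Hn Hh.
  apply (is_derive_ext_loc (fun z => RInt (integrand q c1 eps) rho0 z + C)).
  { generalize (open_itv_locally x y r Hr). apply filter_imp.
    intros z Hz. symmetry. now apply Hfr. }
  rewrite <- (Rplus_0_r (integrand q c1 eps r)).
  apply (is_derive_plus (RInt (integrand q c1 eps) rho0) (fun _ => C));
    [ | apply (is_derive_const C)].
  apply is_derive_RInt with rho0.
  { generalize (open_itv_locally x y r Hr). apply filter_imp.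
    intros z Hz. now apply (RInt_correct (integrand q c1 eps)), Hfr. }
  pose proof (continuous_signed_sqrt x y (radicand q c1) eps r He Hr
                (continuous_radicand q c1 r)) as Hk.
  (* The integrand is A + B * (signed square root) with A, B rational. *)
  set (A := fun s => s * (c1 / s - q / 2) / ((s ^ 2 + 1) * (2 * c1 - q * s))).
  set (B := fun s => s / ((s ^ 2 + 1) * (2 * c1 - q * s))).
  assert (Hden : (r * (r * 1) + 1) * (2 * c1 + - (q * r)) <> 0).
  { apply Rmult_integral_contrapositive_currified; nra. }
  assert (HA : continuous A r)
    by (apply (ex_derive_continuous A); unfold A; auto_derive; easy).
  assert (HB : continuous B r)
    by (apply (ex_derive_continuous B); unfold B; auto_derive; easy).
  apply (continuous_ext (fun s => A s + B s * (eps s * sqrt (radicand q c1 s)))).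
  - intros s. change (A s + B s * (eps s * sqrt (radicand q c1 s)) = integrand q c1 eps s).
    unfold A, B, integrand, Rdiv. ring.
  - exact (continuous_plus _ _ r HA (continuous_mult _ _ r HB Hk)).
Qed.

(** Differentiating the integral gives D = (r / h) * (signed root), where
    h = c1 - q r / 2, hence N^2 = (r / h)^2 off 0; the family requires r / h to be
    positive, which excludes N = - r / h. *)
Lemma first_integral_of_nonzero_family (q : R) (f : R -> R) (x y : Rbar) :
  C2_on x y f -> nonzero_family q f x y ->
  forall r, open_itv x y r -> profile_norm f r <> 0 ->
    is_derive (fun s => s / profile_norm f s) r (- q / 2).
Proof.
  intros Hf (rho0 & c1 & C & eps & _ & _ & He & Hrad & Hsgn & Hfr) r Hr HNr.
  assert (HN : forall s, open_itv x y s -> s <> 0 ->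
            profile_norm f s * (c1 - q / 2 * s) = s).
  { intros s Hs Hn. specialize (Hsgn s Hs Hn). specialize (Hrad s Hs).
    assert (Hh : 2 * c1 - q * s <> 0).
    { intros E. rewrite E in Hsgn. unfold Rdiv in Hsgn. rewrite Rinv_0 in Hsgn. lra. }
    pose proof (is_derive_nonzero_family q f x y rho0 c1 C eps He Hfr s Hs Hn Hh) as Hd.
    apply is_derive_unique in Hd.
    assert (Hp : 0 < s ^ 2 + 1) by nra.
    set (k := eps s * sqrt (radicand q c1 s)).
    assert (Hk : k ^ 2 = radicand q c1 s).
    { unfold k. rewrite Rpow_mult_distr, (sign_choice_sqr _ _ _ _ _ He), pow2_sqrt by easy.
      ring. }
    set (m := s / (2 * c1 - q * s)) in *.
    assert (Hm : 2 * c1 - q * s = s / m) by (unfold m; field; easy).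
    assert (HD : discr_root f s = 2 * m * k).
    { unfold discr_root. rewrite Hd. unfold integrand. fold k.
      unfold m. field. repeat split; trivial; lra. }
    pose proof (discr_root_sqr f s) as HD2. rewrite HD in HD2.
    assert (HN2 : profile_norm f s ^ 2 = (2 * m) ^ 2).
    { apply (Rmult_eq_reg_l (1 + s ^ 2)); [ | lra].
      replace ((1 + s ^ 2) * profile_norm f s ^ 2) with ((2 * m * k) ^ 2 + s ^ 2) by lra.
      rewrite Rpow_mult_distr, Hk.
      replace (radicand q c1 s) with (1 + s ^ 2 - ((2 * c1 - q * s) / 2) ^ 2)
        by (unfold radicand; field).
      rewrite Hm. field. lra. }
    (* The positivity of m selects the root of HN2. *)
    assert (HN1 : profile_norm f s = 2 * m).
    { assert (0 <= profile_norm f s) by apply sqrt_pos. nra. }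
    rewrite HN1. unfold m. field. easy. }
  assert (HN' : forall s, open_itv x y s -> profile_norm f s <> 0 ->
            s / profile_norm f s = c1 - q / 2 * s).
  { intros s Hs HNs.
    (* At s = 0 this reads N 0 * c1 = 0 and is obtained by continuity; it forces
       c1 = 0 when the interval has a non-characteristic origin. *)
    assert (E : profile_norm f s * (c1 - q / 2 * s) - s = 0).
    { destruct (Req_dec s 0) as [-> | Hn]; [ | rewrite HN by easy; ring].
      apply (continuous_eq0_at_0 (fun z => profile_norm f z * (c1 - q / 2 * z) - z)).
      - assert (HdN : ex_derive (profile_norm f) 0)
          by (apply ex_derive_profile_norm; [apply Hf, Hs | easy]).
        revert HdN. generalize (profile_norm f). intros N HdN.
        apply (ex_derive_continuous (fun z => N z * (c1 - q / 2 * z) - z)). auto_derive. easy.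
      - generalize (open_itv_locally x y 0 Hs). apply filter_imp.
        intros z Hz Hzn. rewrite HN by easy. ring. }
    apply (Rmult_eq_reg_l (profile_norm f s)); [ | easy].
    transitivity s; [field; easy | lra]. }
  apply (is_derive_ext_loc (fun s => c1 - q / 2 * s)).
  - assert (HcN : continuous (profile_norm f) r)
      by apply continuous_profile_norm, Hf, Hr.
    generalize (filter_and _ _ (open_itv_locally x y r Hr)
                  (continuous_neq0_locally _ r HcN HNr)).
    apply filter_imp. intros z [Hz HNz]. symmetry; now apply HN'.
  - auto_derive; [easy | field].
Qed.

Theorem theorem4p23 (f : R -> R) (x y : Rbar) (q : R)
  (Hxy : Rbar_lt x y) (Hf : C2_on x y f) :
  (q = 0 -> (const_distortion q f x y <-> zero_family f x y)) /\
  (q <> 0 ->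
     (const_distortion q f x y <->
      forall x' y' : Rbar,
        Rbar_le x x' -> Rbar_lt x' y' -> Rbar_le y' y ->
        noncharacteristic f x' y' -> nonzero_family q f x' y')).
Proof.
  pose proof (const_distortion_iff f x y q Hf) as HQ.
  split; intros Hq; rewrite HQ; clear HQ.
  - assert (E : - q / 2 = 0) by lra. rewrite E. split.
    + now apply zero_family_of_first_integral.
    + now apply first_integral_of_zero_family.
  - split.
    + intros H x' y' Hx Hxy' Hy Hnc.
      pose proof (C2_on_sub f x y x' y' Hx Hy Hf) as Hf'.
      assert (HN : forall r, open_itv x' y' r -> profile_norm f r <> 0)
        by (apply noncharacteristic_iff; [intros r Hr; apply Hf', Hr | easy]).
      apply nonzero_family_of_first_integral; trivial.
      intros r Hr. apply H; [ | now apply HN].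
      destruct Hr; split;
        [now apply Rbar_le_lt_trans with x' | now apply Rbar_lt_le_trans with y'].
    + intros H r Hr HNr.
      assert (HcN : continuous (profile_norm f) r)
        by apply continuous_profile_norm, Hf, Hr.
      destruct (locally_open_subinterval x y _ r Hr (continuous_neq0_locally _ r HcN HNr))
        as (a & b & Hab & Hxa & Hby & HN).
      assert (Hf' : C2_on a b f)
        by (apply (C2_on_sub f x y); trivial; now apply Rbar_lt_le).
      apply (first_integral_of_nonzero_family q f a b); trivial.
      apply H; [now apply Rbar_lt_le | simpl; lra | now apply Rbar_lt_le | ].
      apply noncharacteristic_iff; [intros s Hs; apply Hf', Hs | exact HN].
Qed.
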